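(* Let $\mathfrak X$ be a homogeneous tree of degree $q+1$ ($q\geq1$) and let $k,\ell$ be relatively prime positive integers. For all $f,g,h\in\mathcal F(\mathfrak X)$, the condition $$U_{k-1}(\mu_1)\big(g+U_{\ell-2}(\mu_1)f\big)=U_{\ell-1}(\mu_1)\big(h+U_{k-2}(\mu_1)f\big)$$ is necessary and sufficient for the existence of a unique wave $\{f_j\}_{j\in\mathbb Z}$ with $f_0=f$, $f_\ell=g$, and $f_k=h$.
   Context: $\mathfrak X$ is a tree in which every vertex has exactly $q+1$ edges; $\mathcal F(\mathfrak X)$ is the space of complex-valued functions on its vertices; $\mu_1f(v)=\frac{1}{q+1}\sum_{w\text{ adjacent to }v}f(w)$. A wave is a family $\{f_j\}_{j\in\mathbb Z}$ in $\mathcal F(\mathfrak X)$ with $\mu_1f_j=\frac{f_{j+1}+f_{j-1}}{2}$ for all $j\in\mathbb Z$. $U_n$: Chebyshev polynomials of the second kind, $U_0=1$, $U_1(x)=2x$, $U_n=2xU_{n-1}-U_{n-2}$, with $U_{-n-1}=-U_{n-1}$ for $n\geq0$ (so $U_{-1}=0$, $U_{-2}=-1$); polynomials are applied to the operator $\mu_1$. *)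

(* Defs.v *)
From HB Require Import structures.
From mathcomp Require Import all_boot all_order all_algebra.
From mathcomp Require Import all_classical all_reals.
From mathcomp Require Import complex.

Set Implicit Arguments.
Unset Strict Implicit.
Unset Printing Implicit Defensive.

Import Order.TTheory GRing.Theory Num.Theory.

Local Open Scope classical_set_scope.
Local Open Scope ring_scope.
Local Open Scope card_scope.
Local Open Scope complex_scope.

(* A (possibly infinite) simple graph is a relation [e] on its vertices.      *)
(* The bound on [size c] in the last field is there because, for adjacent [x] *)
(* and [y], the sequence [:: x; y] satisfies [ucycle e].                      *)
Record is_tree (V : choiceType) (e : rel V) : Prop := IsTree {
  tree_inhabited : inhabited V;
  tree_irreflexive : irreflexive e;
  tree_symmetric : symmetric e;
  tree_connected : forall x y : V, exists2 p, path e x p & last x p = y;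
  tree_acyclic : forall c : seq V, (2 < size c)%N -> ~ ucycle e c
}.

Definition homogeneous_tree (q : nat) (V : choiceType) (e : rel V) : Prop :=
  is_tree e /\ forall v : V, [set w | e v w] #= `I_q.+1.

Definition mu1 (R : realType) (q : nat) (V : choiceType) (e : rel V)
    (f : V -> R[i]) : V -> R[i] :=
  fun v => (q.+1%:R)^-1 * \sum_(w \in [set w | e v w]) f w.

Definition is_wave (R : realType) (q : nat) (V : choiceType) (e : rel V)
    (F : int -> V -> R[i]) : Prop :=
  forall (j : int) (v : V), mu1 q e (F j) v = (F (j + 1) v + F (j - 1) v) / 2.

Fixpoint chebU_nat (C : nzRingType) (n : nat) : {poly C} :=
  match n with
  | 0 => 1
  | 1 => 2%:R * 'X
  | (n'.+1 as m).+1 => 2%:R * 'X * chebU_nat C m - chebU_nat C n'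
  end.

(* [Negz n] is the integer [- (n + 1)], so that the negative cases read       *)
(* U_(-1) = 0 and U_(-n-2) = - U_n.                                           *)
Definition chebU (C : nzRingType) (n : int) : {poly C} :=
  match n with
  | Posz m => chebU_nat C m
  | Negz 0 => 0
  | Negz m.+1 => - chebU_nat C m
  end.

Definition poly_op (C : nzRingType) (V : Type) (p : {poly C})
    (T : (V -> C) -> (V -> C)) (f : V -> C) : V -> C :=
  fun v => \sum_(i < size p) p`_i * iter i T f v.

(* Main.v *)
(** A wave is determined by f_0 and f_1 through
    f_j = U_(j-1)(mu_1) f_1 - U_(j-2)(mu_1) f_0, so a wave with f_0 = f,
    f_l = g and f_k = h is the same as a solution p = f_1 of
      U_(l-1)(mu_1) p = g + U_(l-2)(mu_1) f,
      U_(k-1)(mu_1) p = h + U_(k-2)(mu_1) f.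
    For coprime k and l the polynomials U_(k-1) and U_(l-1) are coprime, by
    Euclid's algorithm along U_(m+n) = U_m U_n - U_(m-1) U_(n-1); a Bezout
    relation then shows that the system has at most one solution, and that it
    has one as soon as its right-hand sides are compatible. *)

Require Import Defs.
From HB Require Import structures.
From mathcomp Require Import all_boot all_order all_algebra.
From mathcomp Require Import all_classical all_reals.
From mathcomp Require Import complex ring zify.

Set Implicit Arguments.
Unset Strict Implicit.
Unset Printing Implicit Defensive.

Import Order.TTheory GRing.Theory Num.Theory.

Local Open Scope ring_scope.

(** The recurrence can be solved for [A (j - 1)] as well as for [A (j + 1)], so two consecutive
    values propagate in both directions. It serves for polynomials and for families of functions
    alike. *)
Lemma int_rec2_eq (M : zmodType) (T : M -> M) (A B : int -> M) :
  (forall j, A (j + 1) + A (j - 1) = T (A j)) ->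
  (forall j, B (j + 1) + B (j - 1) = T (B j)) ->
  A 0 = B 0 -> A 1 = B 1 -> A =1 B.
Proof.
move=> recA recB AB0 AB1 j.
suff [] : A j = B j /\ A (j + 1) = B (j + 1) by [].
elim/int_ind: j => [|n [ABn ABn1]|n [ABn ABn1]]; first by rewrite add0r.
- rewrite -addn1 PoszD; split=> //.
  apply: (addIr (A (n%:Z + 1 - 1))).
  by rewrite recA ABn1 -recB addrK ABn.
- have -> : - n.+1%:Z = - n%:Z - 1 by lia.
  rewrite subrK; split=> //.
  apply: (addrI (A (- n%:Z + 1))).
  by rewrite recA ABn -recB ABn1.
Qed.

(** * Chebyshev polynomials indexed by the integers *)

Section ChebyshevPolynomials.
Variable C : comNzRingType.
Local Notation U := (chebU C).

Lemma chebU_rec (j : int) : U (j + 1) + U (j - 1) = 2%:R * 'X * U j.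
Proof.
(* The indices 0, 1, -1 and -2 are separate because the branches of [chebU] and [chebU_nat] meet
   there. *)
case: j => [[|[|n]]|[|[|n]]].
- by rewrite add0r sub0r /= addr0 mulr1.
- exact: subrK.
- have -> : n.+2%:Z + 1 = n.+3%:Z by lia.
  have -> : n.+2%:Z - 1 = n.+1%:Z by lia.
  exact: subrK.
- by rewrite /= subrr mulr0.
- by rewrite /= mulrN mulr1 add0r.
- have -> : Negz n.+2 + 1 = Negz n.+1 by lia.
  have -> : Negz n.+2 - 1 = Negz n.+3 by lia.
  by rewrite /=; ring.
Qed.

(** For fixed m, both sides satisfy the Chebyshev recurrence in n and agree at n = 0 and n = 1. *)
Lemma chebU_add (m n : int) :
  U (m + n) = U m * U n - U (m - 1) * U (n - 1).
Proof.
pose B n := U m * U n - U (m - 1) * U (n - 1).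
apply: (int_rec2_eq (T := fun p => 2%:R * 'X * p) (A := fun n => U (m + n))
  (B := B)) => [j|j||].
- by rewrite !addrA chebU_rec.
- rewrite /B; have := chebU_rec j; have := chebU_rec (j - 1).
  have -> : j - 1 + 1 = j by lia.
  have -> : j + 1 - 1 = j by lia.
  move=> e1 e2.
  transitivity
    (U m * (U (j + 1) + U (j - 1)) - U (m - 1) * (U j + U (j - 1 - 1))).
    ring.
  by rewrite e1 e2; ring.
- by rewrite /B addr0 sub0r /= mulr1 mulr0 subr0.
- have := chebU_rec m; rewrite /B subrr /= mulr1 => e1.
  by apply: (addIr (U (m - 1))); rewrite e1; ring.
Qed.

End ChebyshevPolynomials.

(** One subtractive Euclid step: for m = l - k, U_(l-1) = U_(k-1) U_m - U_(k-2) U_(m-1). Modulo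
    U_(k-1) only the last product remains; U_(m-1) is handled by induction and U_(k-2) by a Bezout
    relation. *)
Lemma coprimep_chebU (C : fieldType) (k l : nat) :
  coprime k l -> coprimep (chebU C (k%:Z - 1)) (chebU C (l%:Z - 1)).
Proof.
have [N leN] := ubnP (k + l)%N; elim: N k l leN => // N IH k l leN co_kl.
wlog le_kl : k l leN co_kl / (k <= l)%N => [hw|].
  have [|/ltnW] := leqP k l; first exact: hw.
  by rewrite coprimep_sym coprime_sym in co_kl *; apply: hw; rewrite // addnC.
case: k => [|k] in leN co_kl le_kl *.
  (* Here k = 0 forces l = 1, and the pair is U_(-1) = 0, U_0 = 1. *)
  by move: co_kl; rewrite /coprime gcd0n => /eqP->; rewrite subrr coprimep1.
pose m := (l - k.+1)%N.
have co_km : coprime k.+1 m.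
  by move: co_kl; rewrite -(subnKC le_kl) /coprime gcdnDl.
have -> : l%:Z - 1 = (k.+1%:Z - 1) + m%:Z by rewrite /m; lia.
rewrite (chebU_add _ (_ - 1) m%:Z) [X in coprimep _ (X - _)]mulrC.
rewrite coprimep_addl_mul -mulNr coprimepMr IH ?andbT //;
  last by rewrite /m; lia.
apply/Bezout_eq1_coprimepP; set n := _ - 1.
(* The addition formula for [n + (- n)] is a Bezout relation. *)
exists (chebU C (- n), chebU C (- n - 1)) => /=.
have := chebU_add C n (- n); rewrite subrr => /= ->; ring.
Qed.

(** * Polynomials in an operator on functions *)

Section PolyOp.
Variables (C : comNzRingType) (V : Type).
Implicit Types (p q : {poly C}) (T : (V -> C) -> V -> C) (f : V -> C).

Lemma poly_op_widen p T f n v : (size p <= n)%N ->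
  poly_op p T f v = \sum_(i < n) p`_i * iter i T f v.
Proof.
move=> le_pn; rewrite /poly_op.
rewrite (big_ord_widen n (fun i => p`_i * iter i T f v) le_pn).
rewrite big_mkcond /=; apply: eq_bigr => i _.
by case: ltnP => // le_pi; rewrite nth_default ?mul0r.
Qed.

Lemma poly_op0 T f : poly_op 0 T f = 0.
Proof. by apply/funext => v; rewrite /poly_op size_poly0 big_ord0. Qed.

Lemma poly_opD p q T f : poly_op (p + q) T f = poly_op p T f + poly_op q T f.
Proof.
apply/funext => v; set n := maxn (size p) (size q).
rewrite (@poly_op_widen _ _ _ n) ?size_polyD // addrfctE.
rewrite !(@poly_op_widen _ _ _ n v) ?leq_max ?leqnn ?orbT // -big_split /=.
by apply: eq_bigr => i _; rewrite coefD mulrDl.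
Qed.

Lemma poly_opZ c p T f : poly_op (c *: p) T f = cst c * poly_op p T f.
Proof.
apply/funext => v; rewrite (@poly_op_widen _ _ _ (size p)) ?size_scale_leq //.
rewrite mulrfctE [poly_op p]lock /= -lock mulr_sumr.
by apply: eq_bigr => i _; rewrite coefZ mulrA.
Qed.

Lemma poly_opB p q T f : poly_op (p - q) T f = poly_op p T f - poly_op q T f.
Proof. by apply: (addIr (poly_op q T f)); rewrite -poly_opD !subrK. Qed.

Lemma poly_opMX p T f : poly_op (p * 'X) T f = poly_op p T (T f).
Proof.
apply/funext => v; rewrite (@poly_op_widen _ _ _ (size p).+1); last first.
  by apply: leq_trans (size_polyMleq _ _) _; rewrite size_polyX addn2.
rewrite big_ord_recl coefMX /= mul0r add0r; apply: eq_bigr => i _.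
by rewrite coefMX /= -iterS iterSr.
Qed.

Lemma poly_op1 T f : poly_op 1 T f = f.
Proof.
by apply/funext => v; rewrite /poly_op size_poly1 big_ord1 coef1 mul1r.
Qed.

Lemma poly_opC c T f : poly_op c%:P T f = cst c * f.
Proof. by rewrite -alg_polyC poly_opZ poly_op1. Qed.

Lemma poly_op_additive p (T : {additive (V -> C) -> V -> C}) :
  zmod_morphism (poly_op p T).
Proof.
elim/poly_ind: p => [|p c IH] f g; first by rewrite !poly_op0 subr0.
by rewrite !poly_opD !poly_opMX !poly_opC raddfB IH mulrBr opprD addrACA.
Qed.

HB.instance Definition _ p (T : {additive (V -> C) -> V -> C}) :=
  GRing.isZmodMorphism.Build (V -> C) (V -> C) (poly_op p T)
    (poly_op_additive p T).

Variable T : {additive (V -> C) -> V -> C}.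
Hypothesis T_scale : forall c f, T (cst c * f) = cst c * T f.

(** [poly_opMX] produces the extra [T] innermost; linearity, that is additivity together with
    [T_scale], brings it outside. *)
Lemma poly_op_comm p f : poly_op p T (T f) = T (poly_op p T f).
Proof.
elim/poly_ind: p f => [|p c IH] f; first by rewrite !poly_op0 raddf0.
by rewrite !poly_opD !poly_opMX !poly_opC IH raddfD /= T_scale.
Qed.

Lemma poly_opM p q f : poly_op (p * q) T f = poly_op p T (poly_op q T f).
Proof.
elim/poly_ind: p f => [|p c IH] f; first by rewrite mul0r !poly_op0.
rewrite mulrDl -mulrA ['X * q]mulrC mulrA mul_polyC !poly_opD !poly_opMX.
by rewrite poly_opZ poly_opC IH poly_op_comm.
Qed.

Lemma poly_op_chebU_rec (j : int) f :
  poly_op (chebU C (j + 1)) T f + poly_op (chebU C (j - 1)) T f =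
    T (poly_op (chebU C j) T f) *+ 2.
Proof.
rewrite -poly_opD chebU_rec -mulrA mulr_natl mulr2n poly_opD -mulr2n mulrC.
by rewrite poly_opMX poly_op_comm.
Qed.

Definition chebyshev_solution f0 f1 (j : int) : V -> C :=
  poly_op (chebU C (j - 1)) T f1 - poly_op (chebU C (j - 2)) T f0.

Lemma chebyshev_solution0 f0 f1 : chebyshev_solution f0 f1 0 = f0.
Proof.
(* U_(-1) = 0 removes [f1], and U_(-2) = -1 gives back [f0]. *)
rewrite /chebyshev_solution poly_op0 sub0r -[_ (0 - 2)]/(- 1).
by rewrite -[- 1]sub0r poly_opB poly_op0 poly_op1 sub0r opprK.
Qed.

Lemma chebyshev_solution1 f0 f1 : chebyshev_solution f0 f1 1 = f1.
Proof. by rewrite /chebyshev_solution poly_op1 poly_op0 subr0. Qed.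

Lemma chebyshev_solution_rec f0 f1 (j : int) :
  chebyshev_solution f0 f1 (j + 1) + chebyshev_solution f0 f1 (j - 1) =
    T (chebyshev_solution f0 f1 j) *+ 2.
Proof.
rewrite /chebyshev_solution raddfB mulrnBl -!poly_op_chebU_rec.
rewrite [X in _ = _ + X]opprD [RHS]addrACA.
by rewrite ![j + 1 - _]addrAC [j - 1 - 2]addrAC.
Qed.

Lemma chebyshev_solution_unique (F : int -> V -> C) :
  (forall j, F (j + 1) + F (j - 1) = T (F j) *+ 2) ->
  F =1 chebyshev_solution (F 0) (F 1).
Proof.
move=> recF; apply: (int_rec2_eq (T := fun u => T u *+ 2) recF) => [j||].
- exact: chebyshev_solution_rec.
- by rewrite chebyshev_solution0.
- by rewrite chebyshev_solution1.
Qed.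

End PolyOp.

(** * The system p(T) x = a, q(T) x = b for coprime p and q *)

Section CoprimePolyOp.
Variables (C : fieldType) (V : Type) (T : {additive (V -> C) -> V -> C}).
Hypothesis T_scale : forall c f, T (cst c * f) = cst c * T f.
Variables p q : {poly C}.
Hypothesis co_pq : coprimep p q.

(** With u p + v q = 1, take x = u(T) a + v(T) b. Compatibility replaces v p b by v q a, so that
    p(T) x = (u p + v q)(T) a = a; the other equation is symmetric. *)
Lemma coprimep_poly_op_solve a b : poly_op p T b = poly_op q T a ->
  exists x, poly_op p T x = a /\ poly_op q T x = b.
Proof.
have /Bezout_eq1_coprimepP[[u v] /= uv1] := co_pq; move=> eq_ab.
exists (poly_op u T a + poly_op v T b).
rewrite !raddfD /= -!(poly_opM T_scale); split.
  rewrite [p * v]mulrC (poly_opM T_scale v) eq_ab -(poly_opM T_scale).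
  by rewrite -poly_opD [p * u]mulrC uv1 poly_op1.
rewrite [q * u]mulrC (poly_opM T_scale u) -eq_ab -(poly_opM T_scale).
by rewrite -poly_opD [q * v]mulrC uv1 poly_op1.
Qed.

Lemma coprimep_poly_op_inj x y :
  poly_op p T x = poly_op p T y -> poly_op q T x = poly_op q T y -> x = y.
Proof.
have /Bezout_eq1_coprimepP[[u v] /= uv1] := co_pq; move=> ep eq.
rewrite -(poly_op1 T x) -(poly_op1 T y) -uv1 !poly_opD !(poly_opM T_scale).
by rewrite ep eq.
Qed.

End CoprimePolyOp.

(** * Linearity of the averaging operator *)

Section Mu1.
Variables (R : realType) (q : nat) (V : choiceType) (e : rel V).
Hypothesis fin_e : forall v, finite_set [set w | e v w]%classic.
Implicit Types f g : V -> R[i]%C.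

Lemma mu1_scale c f : mu1 q e (cst c * f) = cst c * mu1 q e f.
Proof.
apply/funext => v; rewrite /mu1 mulrfctE /=.
by rewrite mulrCA; congr (_ * _); apply/esym/mulr_fsumr.
Qed.

(** The sum in [mu1] defaults to 0 when infinitely many terms are nonzero; finite neighbourhoods
    rule this out. *)
Lemma mu1_additive : zmod_morphism (@mu1 R q V e).
Proof.
move=> f g; have mu1D f1 f2 : mu1 q e (f1 + f2) = mu1 q e f1 + mu1 q e f2.
  apply/funext => v; rewrite /mu1 addrfctE /= -mulrDr.
  by congr (_ * _); apply: (fsbig_split _ _ _ (fin_e v)).
by apply: (addIr (mu1 q e g)); rewrite -mu1D !subrK.
Qed.

End Mu1.

Lemma is_waveP (R : realType) (q : nat) (V : choiceType) (e : rel V)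
    (F : int -> V -> R[i]%C) :
  is_wave q e F <-> forall j, F (j + 1) + F (j - 1) = mu1 q e (F j) *+ 2.
Proof.
split=> wF j; last move=> v.
  by apply/funext => v; rewrite mulr2n !addrfctE wF -splitr.
rewrite -[_ + _]/((F (j + 1) + F (j - 1)) v) wF.
by rewrite mulr2n addrfctE mulrDl -splitr.
Qed.

Local Open Scope complex_scope.

Theorem theorem5p5 (R : realType) (q : nat) (V : choiceType) (e : rel V)
    (k l : nat) (f g h : V -> R[i]) :
  (1 <= q)%N -> homogeneous_tree q e ->
  (0 < k)%N -> (0 < l)%N -> coprime k l ->
  poly_op (chebU R[i] (k%:Z - 1)) (mu1 q e)
      (g + poly_op (chebU R[i] (l%:Z - 2)) (mu1 q e) f) =
    poly_op (chebU R[i] (l%:Z - 1)) (mu1 q e)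
      (h + poly_op (chebU R[i] (k%:Z - 2)) (mu1 q e) f)
  <-> exists! F : int -> V -> R[i],
        [/\ is_wave q e F, F 0 = f, F l%:Z = g & F k%:Z = h].
Proof.
move=> _ [_ deg_e] _ _ co_kl.
have fin_e v : finite_set [set w | e v w]%classic by exists q.+1.
pose T : {additive (V -> R[i]) -> V -> R[i]} :=
  HB.pack (@mu1 R q V e)
    (GRing.isZmodMorphism.Build _ _ _ (mu1_additive q fin_e)).
change (mu1 q e) with (T : (V -> R[i]) -> V -> R[i]).
have T_scale c u : T (cst c * u) = cst c * T u by apply: mu1_scale.
have coU := coprimep_chebU R[i] co_kl.
split=> [compat|[F [[/is_waveP wF F0 Fl Fk] _]]]; last first.
  (* Necessity: both sides of the condition become U_(k-1) U_(l-1) applied to [F 1]. *)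
  have solF := @chebyshev_solution_unique _ _ T T_scale F wF.
  rewrite -Fl -Fk (solF l%:Z) (solF k%:Z) /chebyshev_solution F0 !subrK.
  by rewrite -!(poly_opM T_scale) mulrC.
(* The solution [p] is the value at index 1 of the wave to be built. *)
have [p [pk pl]] := coprimep_poly_op_solve T_scale coU compat.
exists (chebyshev_solution T f p); split=> [|F [/is_waveP wF F0 Fl Fk]].
  split; last 2 first.
  - by rewrite /chebyshev_solution pl addrK.
  - by rewrite /chebyshev_solution pk addrK.
  - by apply/is_waveP; apply: (chebyshev_solution_rec T_scale).
  - exact: chebyshev_solution0.
have solF := @chebyshev_solution_unique _ _ T T_scale F wF.
(* [F 1] solves the same two equations as [p], whose solution is unique. *)
suff -> : p = F 1 by apply/funext => j; rewrite (solF j) F0.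
apply: (coprimep_poly_op_inj T_scale coU); rewrite ?pk ?pl.
  by rewrite -Fk (solF k%:Z) F0 subrK.
by rewrite -Fl (solF l%:Z) F0 subrK.
Qed.
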